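(* For a one-move rider $\mathbb{P}$ with basic move $(c,d)$, where $c,d$ are relatively prime integers, the period of $u_{\mathbb{P}}(q;n,n)$, as a quasipolynomial in $n$ for fixed $q$, is exactly $\max(|c|,|d|)$.
   Context: A one-move rider with basic move $(c,d)$ (move set $\mathbf{M}=\{(c,d)\}$, with $c,d$ relatively prime) is a piece that, from a lattice point $z\in\mathbb{Z}^2$, attacks every lattice point $z+k(c,d)$ with $k\in\mathbb{Z}$, $k\ne 0$. For positive integers $m,n$, the $m\times n$ board is $\{1,\dots,m\}\times\{1,\dots,n\}\subset\mathbb{Z}^2$. $u_{\mathbb{P}}(q;m,n)$ denotes the number of nonattacking configurations of $q$ unlabelled pieces $\mathbb{P}$ on the $m\times n$ board, i.e. the number of $q$-element subsets of the board in which no point is attacked by a piece placed at another point of the subset; $u_{\mathbb{P}}(q;n,n)$ is the case of the square board. Here $q$ is the number of pieces. A function $f$ on the positive integers is a quasipolynomial if there are a positive integer $p$ and polynomials $f_0,\dots,f_{p-1}\in\mathbb{Q}[t]$ such that $f(n)=f_{r}(n)$ whenever $n\equiv r \pmod p$ with $0\le r<p$. The period of $f$ is the smallest such $p$.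
   Formalization: The number of pieces q is assumed to be at least 2; for q = 0 or 1 the counts are 1 and n², which have period 1, so the claim fails there whenever max(|c|,|d|) > 1, for example for basic move (2,1) with q = 1. *)

(* Defs.v *)
From HB Require Import structures.
From mathcomp Require Import all_boot all_order all_algebra.
From mathcomp Require Import boolp.

Set Implicit Arguments.
Unset Strict Implicit.
Unset Printing Implicit Defensive.

Import Order.TTheory GRing.Theory Num.Theory.
Local Open Scope ring_scope.

Definition attacks (v z w : int * int) : Prop :=
  exists k : int, k != 0 /\ w = z + v *~ k.

(* The m x n board {1..m} x {1..n} is indexed by 'I_m * 'I_n, whose ordinals
   start at 0; hence the successors. *)
Definition square_pos (m n : nat) (s : 'I_m * 'I_n) : int * int :=
  ((s.1.+1)%:Z, (s.2.+1)%:Z).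

Definition nonattacking (v : int * int) (m n : nat)
    (S : {set 'I_m * 'I_n}) : Prop :=
  forall x y, x \in S -> y \in S -> x != y ->
    ~ attacks v (square_pos x) (square_pos y).

Definition num_nonattacking (v : int * int) (q m n : nat) : nat :=
  #|[set S : {set 'I_m * 'I_n} | (#|S| == q) && `[< nonattacking v S >]]|.

(* f is only looked at on the positive integers; its value at 0 plays no role. *)
Definition quasipolynomial_mod (f : nat -> rat) (p : nat) : Prop :=
  (0 < p)%N /\
  exists F : 'I_p -> {poly rat},
    forall (r : 'I_p) (n : nat),
      (0 < n)%N -> n = r %[mod p] -> f n = (F r).[n%:R].

Definition is_period (f : nat -> rat) (p : nat) : Prop :=
  quasipolynomial_mod f p /\
  forall p' : nat, quasipolynomial_mod f p' -> (p <= p')%N.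

(* Main.v *)
(* Nonattacking configurations are partial transversals of the lines of the
   board, so their number is the elementary symmetric function e_q of the line
   sizes, and Newton's identities express it through the power sums p_j.  With
   a = max(|c|,|d|) and b = min(|c|,|d|),
     p_j(n) = n^2 + sum_(1 <= k <= n/a) (n - ka)(n - kb) w_j(k),
   where w_j(k) = (k+1)^j - 2 k^j + (k-1)^j.  Summing polynomials up to
   (n - s)/a, s = n mod a, makes p_j, hence e_q, a quasipolynomial mod a.

   For the lower bound compare the constituents at s and at 0.  Those of p_j
   have degree j + 1 but differ only in degree <= j - 1, those of p_1 = n^2 not
   at all, and those of p_2 by (a - b) t (1 - t) n + constant, t = s/a.  So the
   leading term of the difference of the e_q comes from p_1^(q-2) p_2 alone:
   its degree is 2q - 3 and its coefficient is negative when 0 < s < a. *)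

Require Import Defs.
From HB Require Import structures.
From mathcomp Require Import all_boot all_order all_algebra.
From mathcomp Require Import boolp ring zify.

Set Implicit Arguments.
Unset Strict Implicit.
Unset Printing Implicit Defensive.

Import Order.TTheory GRing.Theory Num.Theory.
Local Open Scope ring_scope.

(** * Independent sets of an equivalence relation and Newton's recursion *)

Definition indep (T : finType) (e : rel T) (S : {set T}) : bool :=
  [forall x in S, forall y in S, (x != y) ==> ~~ e x y].

Definition num_indep (T : finType) (e : rel T) (r : nat) : nat :=
  #|[set S : {set T} | (#|S| == r) && indep e S]|.

Definition num_indep_off (T : finType) (e : rel T) (r : nat) (x : T) : nat :=
  #|[set S : {set T} |
      [&& #|S| == r, indep e S & [forall y in S, ~~ e x y]]]|.

Definition class_size (T : finType) (e : rel T) (x : T) : nat :=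
  #|[set y | e x y]|.

(* This is the sum over the classes C of |C|^(i+1) times e_r of the sizes of the
   other classes. *)
Definition indep_moment (T : finType) (e : rel T) (r i : nat) : nat :=
  (\sum_x class_size e x ^ i * num_indep_off e r x)%N.

Lemma indepP (T : finType) (e : rel T) (S : {set T}) :
  reflect {in S &, forall x y, x != y -> ~~ e x y} (indep e S).
Proof.
apply: (iffP forall_inP) => [h x y xS yS|h x xS].
  by move/forall_inP: (h x xS) => /(_ y yS) /implyP.
by apply/forall_inP => y yS; apply/implyP; apply: h.
Qed.

Lemma num_indep_through (T : finType) (e : rel T) (r : nat) (x : T) :
  reflexive e -> symmetric e ->
  #|[set S : {set T} | [&& #|S| == r.+1, indep e S & x \in S]]|
    = num_indep_off e r x.
Proof.
move=> e_refl e_sym; rewrite /num_indep_off.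
set A := [set S : {set T} | [&& #|S| == r, indep e S & [forall y in S, ~~ e x y]]].
have xA (S : {set T}) : S \in A -> x \notin S.
  rewrite inE => /and3P[_ _ /forall_inP h].
  by apply/negP => /h; rewrite e_refl.
have <- : #|[set x |: S | S in A]| = #|A|.
  apply: card_in_imset => S S' SA S'A eqS.
  by rewrite -(setU1K (xA _ SA)) -(setU1K (xA _ S'A)) eqS.
congr #|pred_of_set _|; apply/setP=> S; apply/idP/imsetP.
  rewrite inE => /and3P[/eqP cS /indepP iS xS].
  exists (S :\ x); last by rewrite setD1K.
  rewrite inE; apply/and3P; split.
  - by rewrite -eqSS -cS (cardsD1 x S) xS.
  - by apply/indepP => y z /setD1P[_ yS] /setD1P[_ zS]; apply: iS.
  - by apply/forall_inP=> y /setD1P[yx yS]; apply: iS => //; rewrite eq_sym.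
case=> S' S'A ->; have xS' := xA _ S'A.
move: S'A; rewrite !inE => /and3P[/eqP cS /indepP iS /forall_inP offS].
rewrite eqxx /= andbT cardsU1 xS' cS eqxx /=.
apply/indepP => y z /setU1P[-> | yS] /setU1P[-> | zS] yz.
- by rewrite eqxx in yz.
- exact: offS.
- by rewrite e_sym; apply: offS.
- exact: iS.
Qed.

Lemma num_indep_off_class (T : finType) (e : rel T) (r : nat) (x y : T) :
  symmetric e -> transitive e -> e x y ->
  num_indep_off e r x = num_indep_off e r y.
Proof.
move=> e_sym e_trans exy.
rewrite /num_indep_off; congr #|pred_of_set _|; apply/setP => S; rewrite !inE.
congr [&& _, _ & _]; apply: eq_forallb => z.
by congr (_ ==> ~~ _); apply/idP/idP => h; apply: e_trans h; rewrite // e_sym.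
Qed.

(** An independent set meets the class of [x] in at most one point. Hence, with s the size of that
    class, e_(r+1) of all classes is e_(r+1) of the other classes plus s times e_r of the other
    classes; weight by s^i and sum over [x]. *)
Lemma moment_indep_moment (T : finType) (e : rel T) (r i : nat) :
  reflexive e -> symmetric e -> transitive e ->
  (\sum_x class_size e x ^ i * num_indep e r.+1
    = indep_moment e r.+1 i + indep_moment e r i.+1)%N.
Proof.
move=> e_refl e_sym e_trans; rewrite /indep_moment -big_split /=.
apply: eq_bigr => x _; rewrite expnSr -mulnA -mulnDr; congr (_ * _)%N.
rewrite /class_size -sum_nat_const.
under eq_bigr => y exy.
  have {}exy : e x y by move: exy; rewrite inE.
  rewrite (num_indep_off_class r e_sym e_trans exy) -num_indep_through // -sum1dep_card.
  over.
rewrite (exchange_big_dep (fun S : {set T} => (#|S| == r.+1) && indep e S)) /=; last first.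
  by move=> y S _ /and3P[-> ->].
rewrite /num_indep /num_indep_off.
rewrite -(cardsID [set S : {set T} | [forall y in S, ~~ e x y]]); congr addn.
  by congr #|pred_of_set _|; apply/setP => S; rewrite !inE andbA.
(* Each [S] contributes the number of its points in the class of [x]: none if [S] is off that class,
   exactly one otherwise. *)
rewrite -sum1_card [RHS](bigID (fun S : {set T} => [forall y in S, ~~ e x y])) /=.
rewrite [X in (_ = X + _)%N]big1 ?add0n; last first.
  move=> S /andP[_ /forall_inP offS]; apply: big1 => y; rewrite inE => /andP[exy].
  by case/and3P=> _ _ /offS; rewrite exy.
apply: eq_big => [S|S]; first by rewrite !inE andbC.
rewrite !inE => /andP[/negP offS /andP[cS iS]].
have /exists_inP[y yS exy] : [exists y in S, e x y].
  apply: contraT => /exists_inPn noy; case: offS; apply/forall_inP => y yS.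
  exact: noy.
rewrite (big_pred1 y) // => z; rewrite cS iS inE /=.
apply/andP/eqP => [[exz zS]|->]; last by [].
apply/eqP; apply: contraT => zy; case/negP: (elimT (indepP _ _) iS z y zS yS zy).
by apply: (e_trans x); rewrite // e_sym.
Qed.

(** Double count of the pairs formed by an independent set of r + 1 points and one of its points. *)
Lemma indep_moment0 (T : finType) (e : rel T) (r : nat) :
  reflexive e -> symmetric e ->
  (indep_moment e r 0 = r.+1 * num_indep e r.+1)%N.
Proof.
move=> e_refl e_sym; rewrite /indep_moment.
under eq_bigr => x _.
  rewrite expn0 mul1n -num_indep_through // -sum1dep_card.
  over.
rewrite (exchange_big_dep (fun S : {set T} => (#|S| == r.+1) && indep e S)) /=; last first.
  by move=> x S _ /and3P[-> ->].
rewrite [RHS]mulnC /num_indep -sum_nat_cond_const.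
apply: eq_bigr => S /andP[/eqP cS iS].
by rewrite -cS -sum1_card; apply: eq_bigl => x; rewrite eqxx iS.
Qed.

Lemma indep_moment_init (T : finType) (e : rel T) (i : nat) :
  indep_moment e 0 i = (\sum_x class_size e x ^ i)%N.
Proof.
apply: eq_bigr => x _; rewrite -[RHS]muln1; congr muln.
rewrite /num_indep_off -(cards1 (set0 : {set T})).
congr #|pred_of_set _|; apply/setP => S; rewrite !inE cards_eq0.
case: eqP => // ->.
apply/and3P; split=> //; first by apply/indepP => y z; rewrite inE.
by apply/forall_inP => y; rewrite inE.
Qed.

(** * Lines of the board *)

Section Lines.
Variables (c d : int) (n : nat).
Local Notation cell := ('I_n * 'I_n)%type.

Definition at_step (k : int) (x y : cell) : bool :=
  (y.1%:Z == x.1%:Z + k * c) && (y.2%:Z == x.2%:Z + k * d).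

(** Step 0 is allowed here, unlike in [attacks], so this is an equivalence; its classes are the
    lines. *)
Definition same_line (x y : cell) : bool := `[< exists k, at_step k x y >].

Lemma at_stepP (k : int) (x y : cell) :
  reflect (square_pos y = square_pos x + (c, d) *~ k) (at_step k x y).
Proof.
have -> : (c, d) *~ k = (k * c, k * d).
  rewrite [LHS]surjective_pairing (raddfMz (@fst int int)) (raddfMz (@snd int int)) /=.
  by rewrite -(mulrzr c) -(mulrzr d) intz ![_ * k]mulrC.
rewrite /at_step /square_pos; apply: (iffP andP) => [[/eqP e1 /eqP e2]|[e1 e2]].
  by congr pair => /=; lia.
by split; apply/eqP; lia.
Qed.

Lemma at_stepN (k : int) (x y : cell) : at_step (- k) y x = at_step k x y.
Proof. by rewrite /at_step; congr andb; apply/eqP/eqP; lia. Qed.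

Lemma at_stepD (k l : int) (x y z : cell) :
  at_step k x y -> at_step (k + l) x z = at_step l y z.
Proof.
move=> /andP[/eqP e1 /eqP e2]; rewrite /at_step e1 e2.
by congr andb; rewrite mulrDl addrA.
Qed.

Lemma at_step0 (x y : cell) : at_step 0 x y = (x == y).
Proof.
case: x y => [x1 x2] [y1 y2]; rewrite /at_step /= !mul0r !addr0 xpair_eqE.
by rewrite ![x1 == _]eq_sym ![x2 == _]eq_sym.
Qed.

Lemma at_step_fun (k : int) (x y z : cell) :
  at_step k x y -> at_step k x z -> y = z.
Proof.
by move=> xy; rewrite -[k in at_step k x z]addr0 (at_stepD _ _ xy) at_step0 => /eqP.
Qed.

(** Each coordinate at step [l] lies between its values at steps 0 and [k], so the cell is still on
    the board. *)
Lemma at_step_convex (k l : nat) (x y : cell) : (l <= k)%N ->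
  at_step k x y -> exists z, at_step l x z.
Proof.
case: x y => [x1 x2] [y1 y2] lk /andP[/eqP /= e1 /eqP /= e2].
have := ltn_ord x1; have := ltn_ord x2; have := ltn_ord y1; have := ltn_ord y2.
move=> ? ? ? ?.
have between (u v : nat) (w : int) : (u < n)%N -> (v < n)%N ->
    v%:Z = u%:Z + k%:Z * w -> exists2 j : nat, (j < n)%N & j%:Z = u%:Z + l%:Z * w.
  move=> un vn e.
  have : 0 <= u%:Z + l%:Z * w < n%:Z by case: (lerP 0 w) => w0; nia.
  by exists `|(u%:Z + l%:Z * w)%R|%N; lia.
have [j1 j1n f1] := between _ _ _ (ltn_ord x1) (ltn_ord y1) e1.
have [j2 j2n f2] := between _ _ _ (ltn_ord x2) (ltn_ord y2) e2.
by exists (Ordinal j1n, Ordinal j2n); rewrite /at_step /= f1 f2 !eqxx.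
Qed.

Lemma same_line_refl : reflexive same_line.
Proof. by move=> x; apply/asboolP; exists 0; rewrite at_step0. Qed.

Lemma same_line_sym : symmetric same_line.
Proof.
by move=> x y; apply/asboolP/asboolP => -[k h]; exists (- k); rewrite at_stepN.
Qed.

Lemma same_line_trans : transitive same_line.
Proof.
move=> y x z /asboolP[k xy] /asboolP[l yz]; apply/asboolP; exists (k + l).
by rewrite (at_stepD _ _ xy).
Qed.

Definition line_start (y : cell) : bool := [forall x, ~~ at_step 1 x y].

Lemma line_start_first (x y : cell) (k : int) :
  line_start y -> at_step k y x -> 0 <= k.
Proof.
move=> /forallP sy; case: k => // k; rewrite NegzE -at_stepN opprK => xy.
(* [z] is one step short of [y], hence a predecessor of the line start [y]. *)
have [z xz] := at_step_convex (leqnSn k) xy.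
by case/negP: (sy z); rewrite -(at_stepD 1 y xz) addrC -intS.
Qed.

Hypothesis cd0 : (0 < maxn `|c| `|d|)%N.

Lemma at_step_bound (k : nat) (x y : cell) : at_step k x y -> (k < n)%N.
Proof.
case: x y => [x1 x2] [y1 y2] /andP[/eqP /= e1 /eqP /= e2].
have := ltn_ord x1; have := ltn_ord x2; have := ltn_ord y1; have := ltn_ord y2.
move=> ? ? ? ?.
by move: cd0; rewrite leq_max => /orP[]; nia.
Qed.

Lemma at_step_uniq (k l : nat) (x y : cell) :
  at_step k x y -> at_step l x y -> k = l.
Proof.
case: x y => [x1 x2] [y1 y2] /andP[/eqP /= e1 /eqP /= e2] /andP[/eqP /= f1 /eqP /= f2].
have {}e1 : (k%:Z - l%:Z) * c = 0 by lia.
have {}e2 : (k%:Z - l%:Z) * d = 0 by lia.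
case: (eqVneq k%:Z l%:Z) => [[]//|]; rewrite -subr_eq0 => kl.
move/eqP: e1; move/eqP: e2; rewrite !mulf_eq0 (negPf kl) /= => /eqP d0 /eqP c0.
by move: cd0; rewrite c0 d0.
Qed.

(** Walk back from [x] as far as possible. Two starts on one line are each at a nonnegative step
    from the other, hence equal. *)
Lemma unique_line_start (x : cell) :
  exists y, forall z, (same_line x z && line_start z) = (z == y).
Proof.
pose P k := [exists y, at_step k%:Z y x].
have exP : exists k, P k by exists 0%N; apply/existsP; exists x; rewrite at_step0.
have ubP k : P k -> (k <= n)%N by case/existsP => y /at_step_bound/ltnW.
case: (ex_maxnP exP ubP) => b /existsP[y yx] maxb; exists y => z.
have sy : line_start y.
  apply/forallP => w; apply/negP => wy.
  have /maxb : P b.+1.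
    by apply/existsP; exists w; rewrite intS (at_stepD _ _ wy).
  by rewrite ltnn.
apply/andP/eqP => [[/asboolP[k xz] sz]|->]; last first.
  by split=> //; apply/asboolP; exists (- b%:Z); rewrite at_stepN.
have yz : at_step (b%:Z + k) y z by rewrite (at_stepD _ _ yx).
have bk0 := line_start_first sy yz.
have kb0 : 0 <= - (b%:Z + k) by apply: (line_start_first sz (x := y)); rewrite at_stepN.
have bk : b%:Z + k = 0 by lia.
by move: yz; rewrite bk at_step0 => /eqP.
Qed.

(** By convexity the possible numbers of forward steps from [x] form an initial segment, bounded by
    [at_step_bound]; [f x] is its last element. *)
Lemma forward_steps : exists f : cell -> nat,
  forall x (k : nat), [exists y, at_step k x y] = (k <= f x)%N.
Proof.
suff /choice[f fP] : forall x : cell, exists m : nat, forall k : nat,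
    [exists y, at_step k x y] = (k <= m)%N by exists f.
move=> x; pose P k := [exists y, at_step k%:Z x y].
have exP : exists k, P k by exists 0%N; apply/existsP; exists x; rewrite at_step0.
have ubP k : P k -> (k <= n)%N by case/existsP => y /at_step_bound/ltnW.
case: (ex_maxnP exP ubP) => m /existsP[y xy] maxm; exists m => k.
apply/idP/idP => [|km]; first exact: maxm.
by apply/existsP; apply: at_step_convex km xy.
Qed.

Lemma class_size_line_start (f : cell -> nat) (y : cell) :
  (forall x (k : nat), [exists z, at_step k x z] = (k <= f x)%N) ->
  line_start y -> class_size same_line y = (f y).+1.
Proof.
move=> fP sy.
have /choice[g gP] : forall k : 'I_(f y).+1, exists z, at_step (k : nat) y z.
  by move=> k; apply/existsP; rewrite fP -ltnS.
rewrite -[RHS]card_ord -cardsT -(card_imset _ (f := g)); last first.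
  move=> k l eg; apply: val_inj; apply: (at_step_uniq (gP k)).
  by rewrite eg; apply: gP.
congr #|pred_of_set _|; apply/setP => z; rewrite inE.
apply/asboolP/imsetP => [[k yz]|[k _ ->]]; last by exists k.
have := line_start_first sy yz; case: k yz => // k yz _.
have kf : (k < (f y).+1)%N by rewrite ltnS -fP; apply/existsP; exists z.
by exists (Ordinal kf); last exact: (at_step_fun yz (gP (Ordinal kf))).
Qed.

(* Each line has one start y and f y + 1 cells; and x |-> x + (c, d) sends the
   cells with f x > 0 onto the cells that are not a start. *)
Lemma sum_class_size (f : cell -> nat) (i : nat) :
  (forall x (k : nat), [exists z, at_step k x z] = (k <= f x)%N) ->
  (\sum_x class_size same_line x ^ i + \sum_x f x ^ i.+1
    = \sum_x (f x).+1 ^ i.+1)%N.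
Proof.
move=> fP.
have -> : (\sum_x class_size same_line x ^ i
    = \sum_(y | line_start y) (f y).+1 ^ i.+1)%N.
  transitivity (\sum_x \sum_(y | same_line x y && line_start y)
      class_size same_line y ^ i)%N.
    apply: eq_bigr => x _; have [y yP] := unique_line_start x.
    rewrite (big_pred1 y) //; congr (_ ^ _)%N.
    have /andP[xy _] : same_line x y && line_start y by rewrite yP.
    rewrite /class_size; congr #|pred_of_set _|; apply/setP => z; rewrite !inE.
    by apply/idP/idP => h; apply: same_line_trans h; rewrite // same_line_sym.
  rewrite (exchange_big_dep line_start) /=; last by move=> x y _ /andP[].
  apply: eq_bigr => y sy; rewrite sum_nat_cond_const expnS.
  rewrite -(class_size_line_start fP sy); congr (_ * _)%N.
  rewrite /class_size; congr #|pred_of_set _|; apply/setP => z.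
  by rewrite !inE sy andbT same_line_sym.
rewrite [RHS](bigID line_start) /=; congr addn.
transitivity (\sum_x \sum_(y | at_step 1 x y) (f y).+1 ^ i.+1)%N.
  apply: eq_bigr => x _.
  case: (boolP [exists y, at_step 1 x y]) => [/existsP[y xy]|no].
    rewrite (big_pred1 y) => [|z]; last first.
      by apply/idP/eqP => [xz|->//]; apply: at_step_fun xz xy.
    congr (_ ^ _)%N; apply/eqP.
    have fxy k : (k.+1 <= f x)%N = (k <= f y)%N.
      rewrite -!fP; apply: eq_existsb => z.
      by rewrite intS (at_stepD _ _ xy).
    have := fxy (f x).-1; have := fxy (f y); lia.
  rewrite big_pred0 => [|y]; last by apply/negbTE; move/existsPn: no.
  by move: no; rewrite (fP x 1%N) -leqNgt leqn0 => /eqP->; rewrite exp0n.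
rewrite (exchange_big_dep (fun y => ~~ line_start y)) /=; last first.
  by move=> x y _ xy; apply/negP => /forallP/(_ x)/negP; apply.
apply: eq_bigr => y; rewrite negb_forall => /existsP[x]; rewrite negbK => xy.
rewrite (big_pred1 x) // => z; apply/idP/eqP => [zy|->//].
by apply: (@at_step_fun (- 1) y); rewrite at_stepN.
Qed.

End Lines.

(** * Summation of polynomials *)

(** The first-order Taylor remainder E(p) starts with the second derivative, so the degree drops by
    two. The induction uses E(qX + c) = E(q)(X - t) + t^2 q'. *)
Lemma size_taylor1 (t : rat) (m : nat) (p : {poly rat}) :
  (size p <= m.+2)%N ->
  (size ((p \Po ('X - t%:P)) - p + t%:P * p^`())%R <= m)%N.
Proof.
have step (q : {poly rat}) (c : rat) :
    let E p := (p \Po ('X - t%:P)) - p + t%:P * p^`() in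
    E (q * 'X + c%:P) = E q * ('X - t%:P) + t%:P ^+ 2 * q^`().
  rewrite /= comp_polyD comp_polyM comp_polyX comp_polyC.
  by rewrite derivD derivM derivX derivC; ring.
elim: m p => [|m IHm] p; elim/poly_ind: p => [|q c _];
    rewrite ?comp_poly0 ?deriv0 ?mulr0 ?subrr ?addr0 ?size_poly0 // => sp.
  have /size1_polyC -> : (size q <= 1)%N.
    by move: sp; rewrite size_MXaddC; case: ifP => // /andP[/eqP->]; rewrite size_poly0.
  by rewrite step comp_polyC derivC; rewrite subrr !mulr0 !addr0 mul0r size_poly0.
have sq : (size q <= m.+2)%N.
  by move: sp; rewrite size_MXaddC; case: ifP => // /andP[/eqP->]; rewrite size_poly0.
rewrite step (leq_trans (size_polyD _ _)) // geq_max; apply/andP; split.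
  apply: leq_trans (size_polyMleq _ _) _.
  by rewrite size_XsubC addn2 /= ltnS IHm.
rewrite -polyC_exp mul_polyC (leq_trans (size_scale_leq _ _)) //.
by apply: leq_trans (size_poly _ _) _; move: sq; case: (size q).
Qed.

(** Inverts the backward difference by induction on the degree bound: r_m X^(m+1)/(m+1) has backward
    difference r_m X^m up to lower order. *)
Lemma exists_sumpoly (m : nat) (r : {poly rat}) : (size r <= m)%N ->
  exists S : {poly rat},
    [/\ S.[0] = 0, S - (S \Po ('X - 1%:P)) = r & (size S <= m.+1)%N].
Proof.
elim: m r => [|m IHm] r sr.
  exists 0; rewrite horner0 comp_poly0 subrr size_poly0; split => //.
  by apply/esym/eqP; rewrite -size_poly_leq0.
pose S0 : {poly rat} := (r`_m / m.+1%:R) *: 'X^(m.+1).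
have sS0 : (size S0 <= m.+2)%N.
  by rewrite (leq_trans (size_scale_leq _ _)) // size_polyXn.
have dS0 : S0^`() = r`_m *: 'X^m.
  by rewrite derivZ derivXn /= -scaler_nat scalerA divfK // pnatr_eq0.
have [|S [S_0 dS sS]] := IHm (r - (S0 - (S0 \Po ('X - 1%:P)))).
  have -> : r - (S0 - (S0 \Po ('X - 1%:P))) =
      (r - r`_m *: 'X^m) + ((S0 \Po ('X - 1%:P)) - S0 + 1%:P * S0^`()).
    by rewrite dS0; ring.
  rewrite (leq_trans (size_polyD _ _)) // geq_max size_taylor1 // andbT.
  apply/leq_sizeP => j; rewrite leq_eqVlt coefB coefZ coefXn => /predU1P[<-|mj].
    by rewrite eqxx mulr1 subrr.
  by rewrite gtn_eqF // mulr0 subr0; move/leq_sizeP: sr; apply.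
exists (S0 + S); split.
- by rewrite hornerD S_0 addr0 hornerZ hornerXn expr0n mulr0.
- by rewrite comp_polyD opprD addrACA dS addrC subrK.
- rewrite (leq_trans (size_polyD _ _)) // geq_max sS0 /=; exact: leqW.
Qed.

Definition sumpoly (r : {poly rat}) : {poly rat} :=
  projT1 (cid (exists_sumpoly (leqnn (size r)))).

Lemma sumpolyP (r : {poly rat}) :
  [/\ (sumpoly r).[0] = 0, sumpoly r - (sumpoly r \Po ('X - 1%:P)) = r
    & (size (sumpoly r) <= (size r).+1)%N].
Proof. exact: projT2 (cid (exists_sumpoly (leqnn (size r)))). Qed.

Lemma sumpoly_nat (r : {poly rat}) (k : nat) :
  (sumpoly r).[k%:R] = \sum_(1 <= i < k.+1) r.[i%:R].
Proof.
have [S0 dS _] := sumpolyP r; elim: k => [|k IHk]; first by rewrite big_geq.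
rewrite big_nat_recr //= -IHk; apply/eqP; rewrite addrC -subr_eq; apply/eqP.
rewrite -[in RHS]dS hornerD hornerN horner_comp hornerXsubC.
by rewrite -natr1 addrK.
Qed.

Lemma size_sumpoly (r : {poly rat}) (m : nat) :
  (size r <= m)%N -> (size (sumpoly r) <= m.+1)%N.
Proof. by move=> sr; have [_ _ sS] := sumpolyP r; apply: leq_trans sS _. Qed.

(** Write S for [sumpoly r]. To first order S(X - t) - S is -t S', and [r] = S - S(X - 1) is S'.
    Both errors are Taylor remainders, two degrees below the bound on S. *)
Lemma size_sumpoly_shift (r : {poly rat}) (t : rat) (m : nat) :
  (size r <= m)%N ->
  (size ((sumpoly r \Po ('X - t%:P)) - sumpoly r + t%:P * r)%R <= m.-1)%N.
Proof.
move=> sr; have [_ dS _] := sumpolyP r.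
have sS : (size (sumpoly r) <= m.-1.+2)%N.
  by apply: leq_trans (size_sumpoly sr) _; case: m {sr}.
have -> : (sumpoly r \Po ('X - t%:P)) - sumpoly r + t%:P * r =
    ((sumpoly r \Po ('X - t%:P)) - sumpoly r + t%:P * (sumpoly r)^`())
    - t%:P * ((sumpoly r \Po ('X - 1%:P)) - sumpoly r + 1%:P * (sumpoly r)^`()).
  by rewrite -{3}dS; ring.
rewrite (leq_trans (size_polyD _ _)) // geq_max size_polyN size_taylor1 //=.
by rewrite mul_polyC (leq_trans (size_scale_leq _ _)) // size_taylor1.
Qed.

Lemma poly_eq_arith (p q : {poly rat}) (a s : nat) : (0 < a)%N ->
  (forall k, p.[(a * k + s)%:R] = q.[(a * k + s)%:R]) -> p = q.
Proof.
move=> a0 pq; apply/eqP; rewrite -subr_eq0; apply/eqP.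
apply: (@roots_geq_poly_eq0 _ _
  [seq (a * k + s)%:R | k <- iota 0 (size (p - q))]).
- apply/allP => _ /mapP[k _ ->].
  by rewrite /root hornerD hornerN pq subrr.
- rewrite map_inj_uniq ?iota_uniq // => i j /eqP.
  by rewrite eqr_nat eqn_add2r eqn_pmul2l // => /eqP.
- by rewrite size_map size_iota.
Qed.

(** * Power sums of the line sizes as polynomials in n *)

(** Second central difference of X^(i+1), that is, the weight w_j for j = i + 1. *)
Definition step_weight (i : nat) : {poly rat} :=
  ('X + 1%:P) ^+ i.+1 - 2%:R%:P * 'X ^+ i.+1 + ('X - 1%:P) ^+ i.+1.

(** The Taylor remainders at t = 1 and t = -1 add up to the second difference, since their
    derivative terms cancel. *)
Lemma size_step_weight (i : nat) : (size (step_weight i) <= i)%N.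
Proof.
have -> : step_weight i =
    (('X^(i.+1) \Po ('X - 1%:P)) - 'X^(i.+1) + 1%:P * ('X^(i.+1))^`())
    + (('X^(i.+1) \Po ('X - (-1)%:P)) - 'X^(i.+1) + (-1)%:P * ('X^(i.+1))^`()).
  rewrite /step_weight !comp_Xn_poly !polyCN opprK.
  by ring.
by rewrite (leq_trans (size_polyD _ _)) // geq_max !size_taylor1 ?size_polyXn.
Qed.

Definition last_step (a s : rat) : {poly rat} := a^-1%:P * ('X - s%:P).

(* At n = s mod a the sum runs up to k = (n - s)/a = n %/ a. *)
Definition moment_poly (a b : rat) (i : nat) (s : rat) : {poly rat} :=
  'X ^+ 2 + ('X ^+ 2 * (sumpoly (step_weight i) \Po last_step a s)
    - (a + b)%:P * 'X * (sumpoly ('X * step_weight i) \Po last_step a s)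
    + (a * b)%:P * (sumpoly ('X ^+ 2 * step_weight i) \Po last_step a s)).

Lemma moment_poly_nat (a b i n : nat) : (0 < a)%N ->
  (moment_poly a%:R b%:R i (n %% a)%:R).[n%:R] =
    n%:R ^+ 2 + \sum_(1 <= k < (n %/ a).+1)
      (n%:R - k%:R * a%:R) * (n%:R - k%:R * b%:R) * (step_weight i).[k%:R].
Proof.
move=> a0; have a0' : a%:R != 0 :> rat by rewrite pnatr_eq0 -lt0n.
have eL : (last_step a%:R (n %% a)%:R).[n%:R] = (n %/ a)%:R.
  rewrite /last_step !hornerE {1}(divn_eq n a) natrD natrM addrK mulrC.
  by rewrite mulfK.
rewrite /moment_poly !(hornerD, hornerN, hornerM, hornerC, hornerX, horner_exp).
rewrite !horner_comp eL !sumpoly_nat.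
congr (_ + _); rewrite !mulr_sumr -sumrB -big_split /=.
apply: eq_bigr => k _; rewrite !(hornerM, horner_exp, hornerX); ring.
Qed.

Lemma size_XM (p : {poly rat}) (k m : nat) :
  (size p <= m)%N -> (size ('X ^+ k * p)%R <= k + m)%N.
Proof.
move=> sp; apply: leq_trans (size_polyMleq _ _) _.
by rewrite size_polyXn addSn /= leq_add2l.
Qed.

Lemma size_CM (c : rat) (p : {poly rat}) (m : nat) :
  (size p <= m)%N -> (size (c%:P * p)%R <= m)%N.
Proof. by move=> sp; rewrite mul_polyC (leq_trans (size_scale_leq _ _)). Qed.

Lemma size_D (p q : {poly rat}) (m : nat) :
  (size p <= m)%N -> (size q <= m)%N -> (size (p + q)%R <= m)%N.
Proof. by move=> sp sq; rewrite (leq_trans (size_polyD _ _)) // geq_max sp. Qed.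

Lemma size_B (p q : {poly rat}) (m : nat) :
  (size p <= m)%N -> (size q <= m)%N -> (size (p - q)%R <= m)%N.
Proof. by move=> sp sq; rewrite size_D // size_polyN. Qed.

Lemma size_M (p q : {poly rat}) (m n : nat) :
  (size p <= m.+1)%N -> (size q <= n)%N -> (size (p * q)%R <= m + n)%N.
Proof.
move=> sp sq; apply: leq_trans (size_polyMleq _ _) _.
by move: (size p) (size q) sp sq => k l; lia.
Qed.

Lemma size_comp_last_step (a s : rat) (p : {poly rat}) : a != 0 ->
  size (p \Po last_step a s) = size p.
Proof.
move=> a0; apply: size_comp_poly2.
by rewrite /last_step mul_polyC size_scale ?invr_eq0 // size_XsubC.
Qed.

(** A power of X in front of a sum and a power of k inside it raise the degree equally, so all three
    sums have degree at most i + 2. *)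
Lemma size_moment_poly (a b : rat) (i : nat) (s : rat) : a != 0 ->
  (size (moment_poly a b i s) <= i + 3)%N.
Proof.
move=> a0; have sw := size_step_weight i.
have s0 := size_sumpoly sw.
have s1 : (size (sumpoly ('X * step_weight i)%R) <= i.+2)%N.
  by apply: size_sumpoly; rewrite -['X]expr1; apply: size_XM.
have s2 := size_sumpoly (size_XM 2 sw).
apply: size_D; first by rewrite size_polyXn addn3.
apply: size_D; first apply: size_B.
- by rewrite addn3; apply: (@size_XM _ 2 i.+1); rewrite size_comp_last_step.
- rewrite -mulrA; apply: size_CM; rewrite addn3 -['X]expr1.
  by apply: (@size_XM _ 1 i.+2); rewrite size_comp_last_step.
- by apply: size_CM; rewrite size_comp_last_step // addn3.
Qed.

Lemma sumpoly_uniq (r S : {poly rat}) : S.[0] = 0 ->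
  (forall k : nat, S.[k.+1%:R] = S.[k%:R] + r.[k.+1%:R]) -> sumpoly r = S.
Proof.
move=> S0 dS; apply: (@poly_eq_arith _ _ 1 0) => // k.
rewrite mul1n addn0 sumpoly_nat; elim: k => [|k IHk]; first by rewrite big_geq.
by rewrite big_nat_recr //= IHk dS.
Qed.

(** The second difference of X is zero, which leaves p_1 = n^2, the number of cells, for every
    residue. *)
Lemma moment_poly0 (a b s : rat) : moment_poly a b 0 s = 'X ^+ 2.
Proof.
have w0 : step_weight 0 = 0.
  by apply/eqP; rewrite -size_poly_leq0 size_step_weight.
have S0 : sumpoly 0 = 0.
  by apply: sumpoly_uniq => [|k]; rewrite !horner0 ?addr0.
by rewrite /moment_poly w0 !mulr0 S0 comp_poly0 !mulr0 subrr !addr0.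
Qed.

(* Replacing s = 0 by s shifts the upper end x/a of the sums by t = s/a.  To
   first order this adds -t times the summand at the end point, and there the
   summand vanishes, since x - (x/a) a = 0. *)
Lemma size_moment_poly_diff (a b : rat) (i : nat) (s : rat) : a != 0 ->
  (size (moment_poly a b i s - moment_poly a b i 0)%R <= i.+1)%N.
Proof.
case: i => [|i] a0; first by rewrite !moment_poly0 subrr size_poly0.
have sw := size_step_weight i.+1.
pose t := s / a; pose L := last_step a 0.
pose D (r : {poly rat}) : {poly rat} :=
  (sumpoly r \Po ('X - t%:P)) - sumpoly r + t%:P * r.
have sD (r : {poly rat}) m : (size r <= m)%N -> (size (D r \Po L) <= m.-1)%N.
  by move=> sr; rewrite size_comp_last_step // size_sumpoly_shift.
have eD (r : {poly rat}) : sumpoly r \Po last_step a s =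
    (sumpoly r \Po L) - t%:P * (r \Po L) + (D r \Po L).
  have -> : last_step a s = ('X - t%:P) \Po L.
    rewrite comp_polyB comp_polyX comp_polyC /L /last_step subr0 mulrBr.
    by rewrite -polyCM [a^-1 * s]mulrC.
  rewrite comp_polyA /D !comp_polyD !comp_polyM comp_polyC.
  by rewrite [(- sumpoly r) \Po L]raddfN /=; ring.
have aL : a%:P * L = 'X.
  by rewrite /L /last_step subr0 mulrA -polyCM mulfV // mul1r.
have -> : moment_poly a b i.+1 s - moment_poly a b i.+1 0 =
    'X ^+ 2 * (D (step_weight i.+1) \Po L)
    - (a + b)%:P * 'X * (D ('X * step_weight i.+1) \Po L)
    + (a * b)%:P * (D ('X ^+ 2 * step_weight i.+1) \Po L).
  rewrite /moment_poly !eD -/L !comp_polyM comp_polyX.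
  rewrite ![polyC (_ + _)]polyCD ![polyC (_ * _)]polyCM -aL.
  by ring.
apply: size_D; first apply: size_B.
- by apply: (@size_XM _ 2 i); apply: sD sw.
- rewrite -mulrA; apply: size_CM; rewrite -['X]expr1.
  by apply: (@size_XM _ 1 i.+1); apply: (sD _ i.+2); apply: size_XM.
- by apply: size_CM; apply: (sD _ i.+3); apply: size_XM.
Qed.

(** The weight is the constant 2, so the three sums have closed forms. The coefficient of X,
    positive when b < a and 0 < s < a, is what separates the constituents. *)
Lemma moment_poly1_diff (a b s : rat) : a != 0 ->
  moment_poly a b 1 s - moment_poly a b 1 0 =
    ((a - b) * (s / a) * (1 - s / a))%:P * 'X
    - (3%:R^-1 * b * s * (1 - s / a) * (1 - 2%:R * (s / a)))%:P.
Proof.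
move=> a0.
have w1 : step_weight 1 = 2%:R%:P by rewrite /step_weight polyC_natr; ring.
have S0 : sumpoly 2%:R%:P = 2%:R%:P * 'X.
  apply: sumpoly_uniq => [|k]; rewrite !(hornerD, hornerM, hornerC, hornerX, horner_exp)
    ?mulr0 //.
  by rewrite -natr1; ring.
have S1 : sumpoly ('X * 2%:R%:P) = 'X ^+ 2 + 'X.
  apply: sumpoly_uniq => [|k]; rewrite !(hornerD, hornerM, hornerC, hornerX, horner_exp)
    ?mulr0 ?addr0 //.
  by rewrite -natr1; ring.
have S2 : sumpoly ('X ^+ 2 * 2%:R%:P) =
    3%:R^-1%:P * (2%:R%:P * 'X ^+ 3 + 3%:R%:P * 'X ^+ 2 + 'X).
  apply: sumpoly_uniq => [|k]; rewrite !(hornerD, hornerM, hornerC, hornerX, horner_exp)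
    ?expr0n ?mulr0 ?addr0 ?mulr0 //.
  by rewrite -natr1; field.
apply: (@poly_eq_arith _ _ 1 0) => // k.
rewrite /moment_poly w1 S0 S1 S2 /last_step.
rewrite !(hornerD, hornerN, hornerM, hornerC, hornerX, horner_exp, horner_comp).
by field.
Qed.

(** * Newton's recursion on polynomials: degrees and leading coefficients *)

(* P i stands for the power sum of exponent i + 1; newton P r i is then what
   indep_moment e r i computes, and newton P r 0 / (r + 1) is e_(r+1). *)
Fixpoint newton (P : nat -> {poly rat}) (r : nat) : nat -> {poly rat} :=
  if r is r'.+1 then
    fun i => r%:R^-1%:P * (P i * newton P r' 0) - newton P r' i.+1
  else P.

Lemma newton_horner (P : nat -> {poly rat}) (x : rat) (h : nat -> nat -> rat) :
  (forall i, h 0 i = (P i).[x]) ->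
  (forall r i, h r.+1 i = r.+1%:R^-1 * ((P i).[x] * h r 0) - h r i.+1) ->
  forall r i, h r i = (newton P r i).[x].
Proof.
move=> h0 hS; elim=> [|r IHr] i; first exact: h0.
by rewrite hS /= !(hornerD, hornerN, hornerM, hornerC) !IHr.
Qed.

Lemma coefM_top (p q : {poly rat}) (m n : nat) :
  (size p <= m.+1)%N -> (size q <= n.+1)%N -> (p * q)`_(m + n) = p`_m * q`_n.
Proof.
move=> /leq_sizeP sp /leq_sizeP sq; rewrite coefM.
have lm : (m < (m + n).+1)%N by rewrite ltnS leq_addr.
rewrite (bigD1 (Ordinal lm)) //= addKn big1 ?addr0 // => -[j /= lj].
rewrite -val_eqE /= neq_ltn => /orP[jm|mj]; last by rewrite sp ?mul0r.
by rewrite [q`_ _]sq ?mulr0 //; lia.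
Qed.

Lemma newton_size (P : nat -> {poly rat}) (r i : nat) :
  (forall i, (size (P i) <= i + 3)%N) -> (size (newton P r i) <= r.*2 + i + 3)%N.
Proof.
move=> sP; elim: r i => [|r IHr] i //=.
apply: size_B; last by apply: leq_trans (IHr _) _; lia.
apply/size_CM; apply: (@leq_trans (i.+2 + (r.*2 + 0 + 3))); last by lia.
by apply: size_M => //; apply: leq_trans (sP i) _; lia.
Qed.

(** At each step the degree of [newton P r 1] is too small to interfere, so the leading term comes
    from multiplying by X^2 and dividing by r + 1. *)
Lemma newton_lead_gt0 (P : nat -> {poly rat}) (r : nat) :
  (forall i, (size (P i) <= i + 3)%N) -> P 0 = 'X ^+ 2 ->
  0 < (newton P r 0)`_r.*2.+2.
Proof.
move=> sP P0; elim: r => [|r IHr] /=; first by rewrite P0 coefXn.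
rewrite coefB coefCM P0 coefXnM /= (leq_sizeP _ _ (newton_size r 1 sP)); last by lia.
by rewrite subr0 mulr_gt0 ?invr_gt0 ?ltr0n // -2!addn1 subn2.
Qed.

Lemma newtonB (P Q : nat -> {poly rat}) (r i : nat) :
  newton P r.+1 i - newton Q r.+1 i =
    r.+1%:R^-1%:P * (P i * (newton P r 0 - newton Q r 0)
      + (P i - Q i) * newton Q r 0) - (newton P r i.+1 - newton Q r i.+1).
Proof. by rewrite /=; ring. Qed.

(** Index 0 gains one more degree because P 0 - Q 0 vanishes. To keep the gain, step r + 1 uses the
    sharp bound at index 0 and the general bound at index 1. *)
Lemma newtonB_size (P Q : nat -> {poly rat}) (r : nat) :
  (forall i, (size (P i) <= i + 3)%N) -> (forall i, (size (Q i) <= i + 3)%N) ->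
  (forall i, (size (P i - Q i)%R <= i.+1)%N) -> P 0 = Q 0 ->
  (size (newton P r 0 - newton Q r 0)%R <= r.*2)%N /\
  forall i, (size (newton P r i - newton Q r i)%R <= r.*2 + i.+1)%N.
Proof.
move=> sP sQ sPQ PQ0; elim: r => [|r [IHr0 IHr]].
  by split=> [|i] //=; rewrite PQ0 subrr size_poly0.
have bound i m : (r.*2 + i.+2 <= m)%N ->
    ((size (P i - Q i)%R == 0) || (r.*2 + i.+3 <= m))%N ->
    (size (newton P r.+1 i - newton Q r.+1 i)%R <= m)%N.
  move=> im hm; rewrite newtonB; apply: size_B; last first.
    by apply: leq_trans (IHr _) _; lia.
  apply/size_CM/size_D.
    apply: (@leq_trans (i.+2 + r.*2)); last by lia.
    by apply: size_M => //; apply: leq_trans (sP i) _; lia.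
  case/orP: hm => [|hm].
    by rewrite size_poly_eq0 => /eqP->; rewrite mul0r size_poly0.
  apply: (@leq_trans (i + (r.*2 + 0 + 3))); last by lia.
  by apply: size_M; [exact: sPQ | exact: newton_size].
split=> [|i]; apply: bound; rewrite ?PQ0 ?subrr ?size_poly0 ?eqxx //.
all: try lia.
Qed.

(** In the recursion the difference at index 1, whose coefficient is positive, enters with a minus
    sign; the rest is a positive multiple of X^2 times the earlier difference at index 0, negative
    by induction. *)
Lemma newtonB_coef_lt0 (P Q : nat -> {poly rat}) (r : nat) :
  (forall i, (size (P i) <= i + 3)%N) -> (forall i, (size (Q i) <= i + 3)%N) ->
  (forall i, (size (P i - Q i)%R <= i.+1)%N) ->
  P 0 = 'X ^+ 2 -> Q 0 = 'X ^+ 2 -> 0 < (P 1 - Q 1)`_1 ->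
  (newton P r.+1 0 - newton Q r.+1 0)`_r.*2.+1 < 0.
Proof.
move=> sP sQ sPQ P0 Q0 PQ1.
have PQ0 : P 0 = Q 0 by rewrite P0 Q0.
have sz k := newtonB_size k sP sQ sPQ PQ0.
have top1 k : 0 < (newton P k 1 - newton Q k 1)`_k.*2.+1.
  case: k => [|k]; first exact: PQ1.
  have [s0 s1] := sz k.
  rewrite newtonB coefB (leq_sizeP _ _ (s1 2)); last by lia.
  rewrite subr0 coefCM coefD.
  have -> : (P 1 * (newton P k 0 - newton Q k 0))`_k.+1.*2.+1 = 0.
    have /leq_sizeP -> // : (size (P 1 * (newton P k 0 - newton Q k 0))%R <= 3 + k.*2)%N.
      by apply: size_M => //; apply: leq_trans (sP 1) _.
  have -> : k.+1.*2.+1 = (1 + k.*2.+2)%N by lia.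
  rewrite add0r coefM_top ?sPQ //; last first.
    by apply: leq_trans (newton_size k 0 sQ) _; lia.
  by rewrite !mulr_gt0 ?invr_gt0 ?ltr0n // newton_lead_gt0.
elim: r => [|r IHr].
  by rewrite newtonB /= PQ0 subrr mulr0 mul0r addr0 mulr0 sub0r coefN oppr_lt0 (top1 0).
have PQ00 : P 0 - Q 0 = 0 by rewrite PQ0 subrr.
rewrite newtonB coefB coefCM PQ00 mul0r addr0 P0 coefXnM.
rewrite subr_lt0; apply: lt_trans (top1 r.+1).
have -> : (r.+1.*2.+1 < 2)%N = false by lia.
have -> : (r.+1.*2.+1 - 2)%N = r.*2.+1 by lia.
by rewrite pmulr_rlt0 // invr_gt0 ltr0n.
Qed.

(** * The constituents of the counting function *)

Lemma count_translates (n t : nat) :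
  (\sum_(i < n) \sum_(j < n) (j == i + t :> nat) = n - t)%N.
Proof.
transitivity (\sum_(i < n | i < n - t) 1)%N; last first.
  by rewrite -(big_ord_widen n (fun=> 1%N)) ?leq_subr // sum_nat_const card_ord muln1.
rewrite [RHS]big_mkcond /=; apply: eq_bigr => i _; rewrite ltn_subRL addnC.
case: ltnP => itn.
  rewrite (bigD1 (Ordinal itn)) //= eqxx big1 // => j.
  by rewrite -val_eqE /= => /negbTE->.
by rewrite big1 // => j _; rewrite ltn_eqF // (leq_trans _ itn).
Qed.

Lemma count_int_translates (n k : nat) (c : int) :
  (\sum_(i < n) \sum_(j < n) (j%:Z == (i%:Z + k%:Z * c)%R) = n - k * `|c|)%N.
Proof.
rewrite -count_translates; case: (lerP 0 c) => c0.
  by apply: eq_bigr => i _; apply: eq_bigr => j _; congr nat_of_bool; lia.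
rewrite exchange_big /=.
by apply: eq_bigr => i _; apply: eq_bigr => j _; congr nat_of_bool; lia.
Qed.

Lemma count_at_step (c d : int) (n k : nat) :
  (\sum_x \sum_y @at_step c d n k x y = (n - k * `|c|) * (n - k * `|d|))%N.
Proof.
rewrite -(count_int_translates n k c) -(count_int_translates n k d) big_distrlr /=.
rewrite [RHS]pair_bigA /=; apply: eq_bigr => x _.
rewrite big_distrlr /= [RHS]pair_bigA /=; apply: eq_bigr => y _.
by rewrite mulnb.
Qed.

(** Second differences telescope to first differences; the 1 is the first difference at 0. *)
Lemma sum_step_weight (i m : nat) :
  m.+1%:R ^+ i.+1 - m%:R ^+ i.+1 =
    1 + \sum_(1 <= k < m.+1) (step_weight i).[k%:R].
Proof.
elim: m => [|m IHm]; first by rewrite big_geq // expr1n exprS; ring.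
rewrite big_nat_recr //= addrA -IHm /step_weight.
rewrite !(hornerD, hornerN, hornerM, hornerC, hornerX, horner_exp).
rewrite natr1 -[X in X - 1%R]natr1 addrK.
by move: (m.+2%:R ^+ i.+1) (m.+1%:R ^+ i.+1) (m%:R ^+ i.+1) => u v w; ring.
Qed.

(** By [sum_class_size] and [sum_step_weight] the left side is the sum over the cells x of 1 +
    sum_(1 <= k <= f x) w(k). Since k <= f x means that some cell lies k steps ahead of x,
    exchanging the sums counts the pairs of cells at step k. *)
Lemma moment_same_line (c d : int) (n i : nat) : (0 < maxn `|c| `|d|)%N ->
  ((\sum_x class_size (@same_line c d n) x ^ i)%N)%:R =
  n%:R ^+ 2 + \sum_(1 <= k < n.+1)
    ((n - k * `|c|) * (n - k * `|d|))%:R * (step_weight i).[k%:R].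
Proof.
move=> cd0; have [f fP] := forward_steps n cd0.
have fn x : (f x <= n)%N.
  have /existsP[y] : [exists y, at_step c d (f x) x y] by rewrite fP.
  by move/(at_step_bound cd0)/ltnW.
have /(congr1 (fun m => m%:R : rat)) := sum_class_size cd0 i fP.
rewrite natrD => /(canRL (addrK _)) ->; rewrite !natr_sum -sumrB.
transitivity (\sum_(x : 'I_n * 'I_n) (1 + \sum_(1 <= k < n.+1)
    \sum_(y : 'I_n * 'I_n) (at_step c d k x y)%:R * (step_weight i).[k%:R])).
  apply: eq_bigr => x _; rewrite !natrX sum_step_weight; congr (_ + _).
  rewrite [RHS](big_cat_nat (n := (f x).+1)) //= ?ltnS ?fn //.
  rewrite [X in _ = _ + X]big_nat_cond [X in _ = _ + X]big1 ?addr0.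
    apply: eq_big_nat => k /andP[_ kf].
    have /existsP[y xy] : [exists y, at_step c d k x y] by rewrite fP.
    rewrite (bigD1 y) //= xy mul1r big1 ?addr0 // => z zy.
    case: (boolP (at_step _ _ _ _ _)) => [xz|]; last by rewrite mul0r.
    by rewrite (at_step_fun xz xy) eqxx in zy.
  move=> k /andP[/andP[fk _] _]; apply: big1 => y _.
  have : ~~ [exists y, at_step c d k x y] by rewrite fP -ltnNge.
  by move/existsPn/(_ y)/negbTE->; rewrite mul0r.
rewrite big_split /=; congr (_ + _).
  by rewrite sumr_const card_prod card_ord mulnn natrX.
rewrite exchange_big /=; apply: eq_bigr => k _.
under eq_bigr => x _ do rewrite -mulr_suml -natr_sum.
by rewrite -mulr_suml -natr_sum count_at_step.
Qed.

(** Once k exceeds n / a the truncated factor n - ka is 0; up to there neither subtraction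
    truncates, so the cast to the rationals is exact. *)
Lemma moment_same_line_poly (c d : int) (n i : nat) :
  let a := maxn `|c| `|d| in let b := minn `|c| `|d| in (0 < a)%N ->
  ((\sum_x class_size (@same_line c d n) x ^ i)%N)%:R =
  (moment_poly a%:R b%:R i (n %% a)%:R).[n%:R].
Proof.
move=> a b a0; rewrite moment_same_line // moment_poly_nat //; congr (_ + _).
have na : ((n %/ a).+1 <= n.+1)%N by rewrite ltnS leq_div.
rewrite (big_cat_nat (n := (n %/ a).+1)) //= [X in _ + X]big_nat_cond.
rewrite [X in _ + X]big1 ?addr0 => [|k /andP[/andP[nak _] _]]; last first.
  have nka : (n <= k * a)%N by rewrite ltnW // -ltn_divLR.
  have -> : ((n - k * `|c|) * (n - k * `|d|) = 0)%N.
    move: nka; rewrite /a; case: (leqP `|c| `|d|) => _ h.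
      by have /eqP-> : (n - k * `|d| == 0)%N; rewrite ?subn_eq0 ?muln0.
    by have /eqP-> : (n - k * `|c| == 0)%N; rewrite ?subn_eq0.
  by rewrite mul0r.
apply: eq_big_nat => k /andP[_ kna]; congr (_ * _).
have kan : (k * a <= n)%N by rewrite -leq_divRL.
have kbn : (k * b <= n)%N.
  by apply: leq_trans kan; rewrite leq_mul2l geq_min leq_max leqnn orbT.
rewrite -!natrM -!natrB // -natrM; congr (_%:R).
by rewrite /a /b; case: (leqP `|c| `|d|) => _ //; rewrite mulnC.
Qed.

(** Distinct cells are never at step 0, which reconciles [attacks], with its nonzero [k], with
    [same_line]. *)
Lemma num_nonattackingE (c d : int) (q n : nat) :
  num_nonattacking (c, d) q n n = num_indep (@same_line c d n) q.
Proof.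
congr #|pred_of_set _|; apply/setP => S; rewrite !inE; congr andb.
apply/asboolP/indepP => h x y xS yS xy.
  apply/negP => /asboolP[k xky]; apply: (h x y xS yS xy).
  exists k; split; last exact/at_stepP.
  by apply/eqP => k0; move: xky; rewrite k0 at_step0 (negPf xy).
case=> k [_ /at_stepP xky].
by have /negP := h x y xS yS xy; apply; apply/asboolP; exists k.
Qed.

Definition constituent (c d : int) (q s : nat) : {poly rat} :=
  q%:R^-1%:P *
  newton (fun i => moment_poly (maxn `|c| `|d|)%:R (minn `|c| `|d|)%:R i s%:R) q.-1 0.

(** By [moment_indep_moment] and [indep_moment0], [indep_moment] obeys the recursion that defines
    [newton], with the power sums of the lines as initial values. *)
Lemma num_nonattacking_constituent (c d : int) (q n : nat) :
  (0 < maxn `|c| `|d|)%N -> (0 < q)%N ->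
  (num_nonattacking (c, d) q n n)%:R =
    (constituent c d q (n %% maxn `|c| `|d|)).[n%:R].
Proof.
move=> a0; case: q => // q _.
have e_refl := @same_line_refl c d n; have e_sym := @same_line_sym c d n.
have e_trans := @same_line_trans c d n.
rewrite /constituent hornerM hornerC num_nonattackingE /=.
rewrite -(@newton_horner _ _
  (fun r i => (indep_moment (@same_line c d n) r i)%:R)).
- by rewrite indep_moment0 // natrM mulKf // pnatr_eq0.
- by move=> i; rewrite indep_moment_init moment_same_line_poly.
move=> r i; rewrite -moment_same_line_poly // indep_moment0 // natrM.
rewrite mulrCA mulKf ?pnatr_eq0 // -natrM big_distrl /= moment_indep_moment //.
by rewrite natrD addrK.
Qed.

Lemma constituent_neq (c d : int) (q s : nat) : coprimez c d -> (1 < q)%N ->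
  (0 < s < maxn `|c| `|d|)%N -> constituent c d q s != constituent c d q 0.
Proof.
move=> cop; case: q => [|[|q]] // _ /andP[s0 sa].
set a := maxn _ _ in sa; pose b := minn `|c| `|d|.
have a0 : (0 < a)%N by apply: leq_trans sa.
have a0' : a%:R != 0 :> rat by rewrite pnatr_eq0 -lt0n.
(* If |c| = |d|, coprimality makes both 1, so a = 1 and no s satisfies 0 < s < a. *)
have ba : (b < a)%N.
  rewrite ltnNge; apply/negP => ab.
  have cd : `|c|%N = `|d|%N by move: ab; rewrite /a /b; lia.
  move: cop; rewrite /coprimez /gcdz cd gcdnn => /eqP[] d1.
  by move: sa s0; rewrite /a cd d1 maxnn; case: (s).
rewrite /constituent -subr_eq0 -mulrBr mulf_eq0 polyC_eq0 invr_eq0 pnatr_eq0 /=.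
apply/eqP => e.
have := @newtonB_coef_lt0 (fun i => moment_poly a%:R b%:R i s%:R)
  (fun i => moment_poly a%:R b%:R i 0) q.
rewrite e coef0 ltxx => h; suff : false by []; apply: h.
- by move=> i; apply: size_moment_poly.
- by move=> i; apply: size_moment_poly.
- by move=> i; apply: size_moment_poly_diff.
- exact: moment_poly0.
- exact: moment_poly0.
rewrite moment_poly1_diff // coefB coefCM coefX coefC mulr1 subr0.
have ab' : 0 < a%:R - b%:R :> rat by rewrite subr_gt0 ltr_nat.
have t0 : 0 < s%:R / a%:R :> rat by rewrite divr_gt0 ?ltr0n.
apply: mulr_gt0; first exact: mulr_gt0.
by rewrite subr_gt0 ltr_pdivrMr ?ltr0n // mul1r ltr_nat.
Qed.

Theorem theorem3p2 (c d : int) (q : nat) (hcd : coprimez c d)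
    (hq : (1 < q)%N) :
  is_period (fun n : nat => (num_nonattacking (c, d) q n n)%:R)
    (maxn `|c|%N `|d|%N).
Proof.
have q0 : (0 < q)%N by apply: ltnW.
have a0 : (0 < maxn `|c| `|d|)%N.
  rewrite lt0n; apply: contraTneq hcd => cd0.
  by have [-> ->] : c = 0 /\ d = 0 by lia.
split.
  split=> //; exists (fun r => constituent c d q r) => r n _ nr.
  by rewrite num_nonattacking_constituent // nr modn_small.
move=> p' [p'0 [G GP]]; rewrite leqNgt; apply/negP => p'a.
set a := maxn _ _ in a0 p'a.
(* The residues 0 and p', both below a, are 0 mod p', so their constituents would both equal [G] at
   0, against [constituent_neq]. *)
suff agree s : (s < a)%N -> (p' %| s)%N ->
    constituent c d q s = G (Ordinal p'0).
  have := @constituent_neq c d q p' hcd hq; rewrite -/a p'0 p'a => /(_ isT).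
  by rewrite (agree p') // (agree 0%N) // eqxx.
(* These numbers are s mod a and 0 mod p'; the offset a p' keeps them positive. *)
move=> sa p's; apply: (@poly_eq_arith _ _ (a * p') (a * p' + s)).
  by rewrite muln_gt0 a0.
move=> k; set n := (_ * k + _)%N.
have n0 : (0 < n)%N by rewrite /n !addn_gt0 !muln_gt0 a0 p'0 orbT.
rewrite -(GP _ n) //; last first.
  rewrite /= mod0n; apply/eqP; rewrite -/(p' %| n)%N.
  apply: dvdn_add; first by apply/dvdn_mulr/dvdn_mull.
  by apply: dvdn_add => //; apply: dvdn_mull.
rewrite num_nonattacking_constituent // -/a; congr (constituent _ _ _ _).[_].
by rewrite /n -!mulnA ![(a * _)%N]mulnC addnA -mulnDl modnMDl modn_small.
Qed.
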